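(* Let $\mathcal{H}$ be a saturated homomorph of Lie algebras (over a field $F$). Then, for every finite-dimensional Lie algebra $L$ over $F$, $L\in\mathcal{MH}$ if and only if $L/\phi(L)\in\mathcal{MH}$; that is, $\mathcal{MH}$ is also a saturated homomorph.
   Context: All Lie algebras are finite-dimensional over $F$. The Frattini ideal $\phi(L)$ is the largest ideal of $L$ contained in all maximal subalgebras of $L$ (a maximal subalgebra being a proper subalgebra maximal under inclusion among proper subalgebras). A class $\mathcal{H}$ of finite-dimensional Lie algebras is a homomorph if it contains, along with an algebra $L$, all epimorphic images of $L$; it is saturated if $L/\phi(L)\in\mathcal{H}$ implies $L\in\mathcal{H}$. For a subalgebra $M$ of $L$, a subalgebra $U$ of $L$ is a supplement to $M$ in $L$ if $L=M+U$. $\mathcal{MH}$ is the class of Lie algebras $L$ such that every maximal subalgebra of $L$ has a supplement $U$ in $L$ with $U\in\mathcal{H}$. *)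

(* Defs.v *)
From HB Require Import structures.
From mathcomp Require Import all_boot all_algebra.
From mathcomp Require Import generic_quotient ring_quotient.
From mathcomp Require Import boolp.

Set Implicit Arguments.
Unset Strict Implicit.
Unset Printing Implicit Defensive.

Import GRing.Theory.
Local Open Scope ring_scope.
Local Open Scope quotient_scope.

(* Finite-dimensionality comes from the vectType structure. *)
HB.mixin Record isLie (F : fieldType) (L : Type) of Vector F L := {
  bracket : L -> L -> L;
  bracket_linl : forall z, linear (bracket^~ z);
  bracket_linr : forall x, linear (bracket x);
  bracketxx : forall x, bracket x x = 0;
  jacobi : forall x y z,
    bracket x (bracket y z) + bracket y (bracket z x)
      + bracket z (bracket x y) = 0
}.

#[short(type="lieType")]
HB.structure Definition Lie (F : fieldType) := {L of isLie F L & Vector F L}.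

Section LieTheory.
Variables (F : fieldType) (L : lieType F).
Implicit Types (x y z : L) (a : F).

Lemma bracketDl x y z : bracket (x + y) z = bracket x z + bracket y z.
Proof. by have := bracket_linl z 1 x y; rewrite !scale1r. Qed.

Lemma bracketDr x y z : bracket x (y + z) = bracket x y + bracket x z.
Proof. by have := bracket_linr x 1 y z; rewrite !scale1r. Qed.

Lemma bracketNC x y : bracket y x = - bracket x y.
Proof.
apply/eqP; rewrite -addr_eq0; apply/eqP.
have := bracketxx (x + y).
by rewrite bracketDl !bracketDr !bracketxx add0r addr0 addrC.
Qed.

Lemma bracket0l x : bracket 0 x = 0.
Proof. by have := bracket_linl x (-1) 0 0; rewrite !scaleN1r oppr0 addr0 addNr. Qed.

Lemma bracket0r x : bracket x 0 = 0.
Proof. by rewrite bracketNC bracket0l oppr0. Qed.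

Lemma bracketNl x y : bracket (- x) y = - bracket x y.
Proof. by have := bracket_linl y (-1) x 0; rewrite !scaleN1r addr0 bracket0l addr0. Qed.

Lemma bracketNr x y : bracket x (- y) = - bracket x y.
Proof. by rewrite bracketNC bracketNl -bracketNC. Qed.

Definition is_subalgebra (U : {vspace L}) : Prop :=
  forall x y, x \in U -> y \in U -> bracket x y \in U.

(* Since the bracket is anticommutative, left ideals are two-sided. *)
Definition is_ideal (I : {vspace L}) : Prop :=
  forall x y, y \in I -> bracket x y \in I.

Record subalgebra := Subalgebra {
  subalg_vs :> {vspace L};
  subalgP : is_subalgebra subalg_vs
}.

Record ideal := Ideal {
  ideal_vs :> {vspace L};
  idealP : is_ideal ideal_vs
}.

Definition maximal_subalgebra (M : {vspace L}) : Prop :=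
  [/\ is_subalgebra M, M != fullv
    & forall U : {vspace L}, is_subalgebra U -> U != fullv ->
        (M <= U)%VS -> U = M].

End LieTheory.

Section SubLie.
Variables (F : fieldType) (L : lieType F) (U : subalgebra L).
Implicit Types x y z : subvs_of U.

Definition sub_bracket x y : subvs_of U :=
  Subvs (subalgP (subvsP x) (subvsP y)).

Fact sub_bracket_linl z : linear (sub_bracket^~ z).
Proof. by move=> a x y; apply/val_inj; exact: bracket_linl. Qed.

Fact sub_bracket_linr x : linear (sub_bracket x).
Proof. by move=> a y z; apply/val_inj; exact: bracket_linr. Qed.

Fact sub_bracketxx x : sub_bracket x x = 0.
Proof. by apply/val_inj; exact: bracketxx. Qed.

Fact sub_jacobi x y z :
  sub_bracket x (sub_bracket y z) + sub_bracket y (sub_bracket z x)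
    + sub_bracket z (sub_bracket x y) = 0.
Proof. by apply/val_inj; exact: jacobi. Qed.

HB.instance Definition _ := isLie.Build F (subvs_of U)
  sub_bracket_linl sub_bracket_linr sub_bracketxx sub_jacobi.

End SubLie.

Section LieQuotient.
Variables (F : fieldType) (L : lieType F) (I : ideal L).

Definition lie_quot : Type :=
  Quotient.quot (pred_of_vspace I : zmodClosed L).

HB.instance Definition _ := GRing.Zmodule.on lie_quot.

Definition quot_proj (x : L) : lie_quot := \pi_lie_quot x.
Local Notation p := quot_proj.

Implicit Types (q r s : lie_quot) (a b : F).

Lemma quot_projP x y : reflect (p x = p y) (x - y \in I).
Proof.
apply: (iffP idP); first by rewrite [_ \in _]Quotient.idealrBE => /eqP.
by move=> exy; rewrite [_ \in _]Quotient.idealrBE; apply/eqP.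
Qed.

Lemma quot_projK q : p (repr q) = q.
Proof. exact: reprK. Qed.

Lemma quot_projD x y : p (x + y) = p x + p y.
Proof. exact: (raddfD (\pi_lie_quot)). Qed.

Lemma mem_repr_sub x : repr (p x) - x \in I.
Proof. by apply/quot_projP; rewrite quot_projK. Qed.

Definition quot_scale a q : lie_quot := p (a *: repr q).

Lemma quot_projZ a x : quot_scale a (p x) = p (a *: x).
Proof. by apply/quot_projP; rewrite -scalerBr memvZ // mem_repr_sub. Qed.

Fact quot_scalerA a b q : quot_scale a (quot_scale b q) = quot_scale (a * b) q.
Proof. by rewrite -[q]quot_projK !quot_projZ scalerA. Qed.

Fact quot_scale1r : left_id 1 quot_scale.
Proof. by move=> q; rewrite -[q]quot_projK quot_projZ scale1r. Qed.

Fact quot_scalerDr : right_distributive quot_scale +%R.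
Proof.
move=> a q r; rewrite -[q]quot_projK -[r]quot_projK.
by rewrite -quot_projD !quot_projZ scalerDr quot_projD.
Qed.

Fact quot_scalerDl q : {morph quot_scale^~ q : a b / a + b}.
Proof.
by move=> a b; rewrite -[q]quot_projK !quot_projZ scalerDl quot_projD.
Qed.

HB.instance Definition _ := GRing.Zmodule_isLmodule.Build F lie_quot
  quot_scalerA quot_scale1r quot_scalerDr quot_scalerDl.

Fact quot_proj_linear : linear quot_proj.
Proof. by move=> a x y; rewrite quot_projD -quot_projZ. Qed.

HB.instance Definition _ :=
  GRing.isLinear.Build F L lie_quot _ quot_proj quot_proj_linear.

Lemma quot_proj_eq0 x : (quot_proj x == 0) = (x \in I).
Proof.
rewrite -[0](raddf0 quot_proj).
by apply/eqP/idP => [/quot_projP|xI]; last apply/quot_projP; rewrite subr0.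
Qed.

(* The coordinates of a coset are those of its representative in a complement
   of I. *)
Fact quot_vect_iso : Vector.axiom (\dim (I^C)%VS) lie_quot.
Proof.
pose g x : subvs_of (I^C)%VS := Subvs (memv_projC I x).
have gB x y : g (x - y) = g x - g y.
  by apply: val_inj; rewrite /= linearB !opprD addrACA.
have gI x : x \in I -> g x = 0.
  by move=> xI; apply: val_inj; rewrite /= projv_id ?subrr.
have gp x : g (repr (p x)) = g x.
  by apply/eqP; rewrite -subr_eq0 -gB gI // mem_repr_sub.
have gC (u : subvs_of (I^C)%VS) : g (val u) = u.
  apply: val_inj => /=; move: (val u) (subvsP u) => x.
  by rewrite -lker_proj memv_ker => /eqP->; rewrite subr0.
have [c c_lin c_bij] := subvs_vect_iso (I^C)%VS.
exists (fun q => c (g (repr q))).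
  move=> a q r; rewrite -c_lin -[q]quot_projK -[r]quot_projK -quot_proj_linear !gp.
  congr c; apply: val_inj => /=.
  by rewrite linearP scalerBr opprD addrACA.
have [d cK dK] := c_bij; exists (fun v => p (val (d v))) => [q | v]; last by rewrite gp gC dK.
rewrite cK -[RHS]quot_projK; apply/quot_projP.
by rewrite /= addrAC subrr add0r memvN memv_proj.
Qed.

HB.instance Definition _ :=
  Lmodule_hasFinDim.Build F lie_quot quot_vect_iso.

Definition quot_bracket q r : lie_quot := p (bracket (repr q) (repr r)).

Lemma quot_proj_bracket x y : quot_bracket (p x) (p y) = p (bracket x y).
Proof.
apply/quot_projP; set x' := repr _; set y' := repr _.
have -> : bracket x' y' - bracket x y
    = bracket x' (y' - y) - bracket y (x' - x).
  rewrite !bracketDr !bracketNr opprB [bracket y x]bracketNC.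
  by rewrite [bracket y x']bracketNC opprK addrACA addNr addr0 addrC.
by rewrite memvB // idealP // mem_repr_sub.
Qed.

Fact quot_bracket_linl r : linear (quot_bracket^~ r).
Proof.
move=> a q s; rewrite -[q]quot_projK -[r]quot_projK -[s]quot_projK.
by rewrite -linearP !quot_proj_bracket bracket_linl linearP.
Qed.

Fact quot_bracket_linr q : linear (quot_bracket q).
Proof.
move=> a r s; rewrite -[q]quot_projK -[r]quot_projK -[s]quot_projK.
by rewrite -linearP !quot_proj_bracket bracket_linr linearP.
Qed.

Fact quot_bracketxx q : quot_bracket q q = 0.
Proof. by rewrite /quot_bracket bracketxx linear0. Qed.

Fact quot_jacobi q r s :
  quot_bracket q (quot_bracket r s) + quot_bracket r (quot_bracket s q)
    + quot_bracket s (quot_bracket q r) = 0.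
Proof.
rewrite -[q]quot_projK -[r]quot_projK -[s]quot_projK.
by rewrite !quot_proj_bracket -!linearD jacobi linear0.
Qed.

HB.instance Definition _ := isLie.Build F lie_quot
  quot_bracket_linl quot_bracket_linr quot_bracketxx quot_jacobi.

Lemma quot_projM x y : p (bracket x y) = bracket (p x) (p y).
Proof. by rewrite -quot_proj_bracket. Qed.

End LieQuotient.

Section Frattini.
Variables (F : fieldType) (L : lieType F).

Definition in_all_maximal (I : {vspace L}) : Prop :=
  forall M : {vspace L}, maximal_subalgebra M -> (I <= M)%VS.

Definition is_frattini (I : {vspace L}) : Prop :=
  [/\ is_ideal I, in_all_maximal I
    & forall J : {vspace L}, is_ideal J -> in_all_maximal J -> (J <= I)%VS].

Lemma is_frattini_unique I J : is_frattini I -> is_frattini J -> I = J.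
Proof.
move=> [iI mI maxI] [iJ mJ maxJ]; apply/eqP.
by rewrite eqEsubv maxJ ?maxI.
Qed.

Lemma is_frattini_exists : exists I, is_frattini I.
Proof.
pose P n := `[< exists I : {vspace L},
  [/\ is_ideal I, in_all_maximal I & \dim I = n] >].
have P0 : exists n, P n.
  exists 0%N; apply/asboolP; exists 0%VS; split; last exact: dimv0.
  - by move=> x y; rewrite memv0 => /eqP->; rewrite bracket0r mem0v.
  - by move=> M _; exact: sub0v.
have Pmax n : P n -> (n <= \dim {:L})%N.
  by move=> /asboolP[I [_ _ <-]]; exact/dimvS/subvf.
case: (ex_maxnP P0 Pmax) => _ /asboolP[I [iI mI <-]] maxI.
exists I; split=> // J iJ mJ.
suff /eqP-> : (I == I + J)%VS by exact: addvSr.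
rewrite eqEdim addvSl maxI //; apply/asboolP; exists (I + J)%VS; split=> //.
- move=> x _ /memv_addP[u uI [v vJ ->]].
  by rewrite bracketDr memv_add ?iI ?iJ.
- by move=> M maxM; rewrite subv_add mI ?mJ.
Qed.

Definition frattini : ideal L :=
  let I := cid is_frattini_exists in
  Ideal (let: And3 iI _ _ := svalP I in iI).

Lemma frattiniP : is_frattini frattini.
Proof. by rewrite /frattini /=; case: cid. Qed.

End Frattini.

Definition is_lie_hom (F : fieldType) (L K : lieType F) (f : 'Hom(L, K)) : Prop :=
  {morph f : x y / bracket x y}.

Definition is_epimorphic_image (F : fieldType) (L K : lieType F) : Prop :=
  exists2 f : 'Hom(L, K), is_lie_hom f & limg f = fullv.

Definition homomorph (F : fieldType) (H : lieType F -> Prop) : Prop :=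
  forall L K : lieType F, H L -> is_epimorphic_image L K -> H K.

Definition saturated (F : fieldType) (H : lieType F -> Prop) : Prop :=
  forall L : lieType F, H (lie_quot (frattini L)) -> H L.

Definition is_supplement (F : fieldType) (L : lieType F) (M U : {vspace L}) : Prop :=
  (M + U)%VS = fullv.

Definition MH (F : fieldType) (H : lieType F -> Prop) (L : lieType F) : Prop :=
  forall M : {vspace L}, maximal_subalgebra M ->
    exists2 U : subalgebra L, is_supplement M U & H (subvs_of U).

(* Main.v *)
Require Import Defs.
From mathcomp Require Import all_boot all_algebra.
From mathcomp Require Import boolp.

(** Maximal subalgebras correspond under an epimorphism [f : L -> K]: preimages
    of maximal subalgebras of [K] are maximal in [L], and images of maximal
    subalgebras of [L] that contain the kernel are maximal in [K].  Pulling a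
    maximal subalgebra of [K] back to [L], supplementing it there and pushing
    the supplement forward shows that [MH H] is closed under epimorphic images
    ([homomorph_MH]).

    For saturation, let [f : L -> L / phi(L)] be the projection and [M] a
    maximal subalgebra of [L].  Since [M] contains [phi(L)], its image has a
    supplement [V] in [H].  The full preimage of [V] supplements [M] but need
    not lie in [H], so it is shrunk: among the subalgebras of [L] with image [V]
    let [U] have least dimension.  The epimorphism [U -> V] is then essential,
    in that no proper subalgebra of [U] still maps onto [V].  This forces its
    kernel into every maximal subalgebra [N] of [U], for otherwise [N] together
    with the kernel would be all of [U] and [N] would map onto [V].  So the
    kernel lies in [phi(U)], the algebra [U / phi(U)] is an image of [V], and
    [U] is in [H] because [H] is a saturated homomorph
    ([saturated_essential_cover]).  Finally [M + U = L], as [M] contains the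
    kernel of [f] and the images of [M] and [U] span. *)

Set Implicit Arguments.
Unset Strict Implicit.
Unset Printing Implicit Defensive.

Import GRing.Theory.
Local Open Scope ring_scope.

Lemma eq_fullv (F : fieldType) (V : vectType F) (U : {vspace V}) :
  (fullv <= U)%VS -> U = fullv.
Proof. by move=> TU; apply: subv_anti; rewrite subvf. Qed.

Section Homomorphisms.
Variables (F : fieldType) (L K : lieType F) (f : 'Hom(L, K)).
Hypothesis fM : is_lie_hom f.

Lemma subalgebra_img (U : {vspace L}) :
  is_subalgebra U -> is_subalgebra (f @: U)%VS.
Proof.
move=> sU _ _ /memv_imgP[x xU ->] /memv_imgP[y yU ->].
by rewrite -fM memv_img // sU.
Qed.

Lemma subalgebra_preim (V : {vspace K}) :
  is_subalgebra V -> is_subalgebra (f @^-1: V)%VS.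
Proof. by move=> sV x y; rewrite -!memv_preim fM; exact: sV. Qed.

Lemma ideal_lker : is_ideal (lker f).
Proof. by move=> x y; rewrite !memv_ker fM => /eqP->; rewrite bracket0r. Qed.

Lemma img_preim (V : {vspace K}) : limg f = fullv -> (f @: (f @^-1: V))%VS = V.
Proof.
by move=> f_onto; apply: lpreimK; rewrite f_onto subvf.
Qed.

Lemma subv_of_img (U W : {vspace L}) :
  (lker f <= W)%VS -> (f @: U <= f @: W)%VS -> (U <= W)%VS.
Proof.
move=> kW fUW; apply/subvP=> x xU.
have /memv_imgP[w wW fxw] := subvP fUW _ (memv_img f xU).
rewrite -(subrK w x) rpredD // (subvP kW) // memv_ker.
by rewrite linearB /= fxw subrr.
Qed.

Lemma corestriction (U : subalgebra L) (V : subalgebra K) :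
  (f @: U)%VS = V ->
  exists g : 'Hom(subvs_of U, subvs_of V),
    [/\ is_lie_hom g, limg g = fullv
      & forall u, val (g u) = f (val u)].
Proof.
move=> fUV; pose g := linfun (vsproj V \o f \o (vsval : subvs_of U -> L)).
have gE u : val (g u) = f (val u).
  by rewrite lfunE /= vsprojK // -fUV memv_img // subvsP.
exists g; split=> // [x y|]; first by apply: val_inj; rewrite gE /= fM -!gE.
apply: eq_fullv; apply/subvP=> v _.
have /memv_imgP[u uU fu] : val v \in (f @: U)%VS by rewrite fUV subvsP.
suff -> : v = g (Subvs uU) by rewrite memv_img ?memvf.
by apply: val_inj; rewrite gE.
Qed.

Lemma maximal_subalgebra_preim (M : {vspace K}) :
  limg f = fullv -> maximal_subalgebra M ->
  maximal_subalgebra (f @^-1: M)%VS.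
Proof.
move=> f_onto [sM M_proper M_max]; split; first exact: subalgebra_preim.
  apply: contraNneq M_proper => fM_full.
  by rewrite -(img_preim M f_onto) fM_full f_onto.
move=> U sU U_proper MU.
have kU : (lker f <= U)%VS.
  by apply: subv_trans MU; rewrite -lpreim0 lpreimS ?sub0v.
have fU : (f @: U)%VS = M.
  apply: M_max; first exact: subalgebra_img.
    apply: contraNneq U_proper => fU_full.
    by apply/eqP/eq_fullv; apply: subv_of_img => //; rewrite f_onto fU_full.
  by rewrite -[X in (X <= _)%VS](img_preim M f_onto) limgS.
have kM : (lker f <= f @^-1: M)%VS by rewrite -lpreim0 lpreimS ?sub0v.
apply: subv_anti; rewrite MU andbT.
by apply: (subv_of_img kM); rewrite img_preim // fU subvv.
Qed.

Lemma maximal_subalgebra_img (M : {vspace L}) :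
  limg f = fullv -> (lker f <= M)%VS -> maximal_subalgebra M ->
  maximal_subalgebra (f @: M)%VS.
Proof.
move=> f_onto kM [sM M_proper M_max]; split; first exact: subalgebra_img.
  apply: contraNneq M_proper => fM_full.
  by apply/eqP/eq_fullv; apply: subv_of_img => //; rewrite f_onto fM_full.
move=> W sW W_proper fMW; rewrite -(img_preim W f_onto); congr (f @: _)%VS.
apply: M_max; first exact: subalgebra_preim.
  apply: contraNneq W_proper => fW_full.
  by rewrite -(img_preim W f_onto) fW_full f_onto.
by apply/subvP=> x xM; rewrite -memv_preim (subvP fMW) // memv_img.
Qed.

(** First isomorphism theorem, in the form of a factorization.  Any linear
    section of [f] serves: it need not respect brackets, but its failure to do
    so lies in [lker f], which [h] kills. *)
Lemma epimorphic_image_factor (Q : lieType F) (h : 'Hom(L, Q)) :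
    limg f = fullv -> is_lie_hom h -> limg h = fullv ->
  (lker f <= lker h)%VS -> is_epimorphic_image K Q.
Proof.
move=> f_onto hM h_onto kfh; pose s := (f^-1)%VF.
have fs y : f (s y) = y by rewrite limg_lfunVK // f_onto memvf.
have h_ext x y : f x = f y -> h x = h y.
  move=> fxy; apply/eqP; rewrite -subr_eq0 -linearB /= -memv_ker.
  by rewrite (subvP kfh) // memv_ker linearB /= fxy subrr.
exists (h \o s)%VF => [x y|].
  by rewrite !comp_lfunE -hM; apply: h_ext; rewrite fM !fs.
apply: eq_fullv; rewrite -h_onto; apply/subvP=> _ /memv_imgP[x _ ->].
apply/memv_imgP; exists (f x); first exact: memvf.
by rewrite comp_lfunE; apply: h_ext; rewrite fs.
Qed.

End Homomorphisms.

Section Quotient.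
Variables (F : fieldType) (L : lieType F) (I : ideal L).

Definition quot_hom : 'Hom(L, lie_quot I) := linfun (@quot_proj F L I).

Lemma quot_hom_is_lie_hom : is_lie_hom quot_hom.
Proof. by move=> x y; rewrite !lfunE /= quot_projM. Qed.

Lemma quot_hom_onto : limg quot_hom = fullv.
Proof.
apply: eq_fullv; apply/subvP=> q _.
by apply/memv_imgP; exists (repr q); rewrite ?memvf // lfunE /= quot_projK.
Qed.

Lemma lker_quot_hom : lker quot_hom = I.
Proof. by apply/vspaceP=> x; rewrite memv_ker lfunE /= quot_proj_eq0. Qed.

End Quotient.

(** The sum of a subalgebra and an ideal is again a subalgebra, so maximality of
    [N] leaves no room strictly between [N] and the whole algebra. *)
Lemma maximal_subalgebra_ideal (F : fieldType) (L : lieType F)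
    (N I : {vspace L}) :
  maximal_subalgebra N -> is_ideal I -> ~~ (I <= N)%VS -> (N + I)%VS = fullv.
Proof.
move=> [sN _ N_max] idI IN; apply/eqP; apply: contraNT IN => NI_proper.
rewrite -(N_max _ _ NI_proper (addvSl N I)) ?addvSr //.
move=> _ _ /memv_addP[x xN [i iI ->]] /memv_addP[y yN [j jI ->]].
rewrite bracketDr bracketDl -addrA memv_add ?sN //.
by rewrite memvD ?(idI _ j) // bracketNC memvN idI.
Qed.

Section Supplements.
Variables (F : fieldType) (H : lieType F -> Prop).
Hypothesis homH : homomorph H.

(** The kernel of an essential epimorphism lies in every maximal subalgebra of
    its source [A], hence in [frattini A]; so [A] modulo its Frattini ideal is
    an epimorphic image of [B]. *)
Lemma saturated_essential_cover (A B : lieType F) (g : 'Hom(A, B)) :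
    saturated H -> is_lie_hom g -> limg g = fullv ->
    (forall N : {vspace A}, is_subalgebra N -> (g @: N)%VS = fullv ->
       N = fullv) ->
  H B -> H A.
Proof.
move=> satH gM g_onto g_ess HB; apply: satH; apply: homH HB _.
have [_ _ phi_max] := frattiniP A.
apply: (epimorphic_image_factor (h := quot_hom (frattini A)) gM g_onto).
- exact: quot_hom_is_lie_hom.
- exact: quot_hom_onto.
rewrite lker_quot_hom; apply: phi_max; first exact: ideal_lker.
move=> N N_max; apply: contraT => kN; have [sN /eqP N_proper _] := N_max.
case: N_proper; apply: g_ess => //.
have NkT := maximal_subalgebra_ideal N_max (ideal_lker gM) kN.
have := congr1 (lfun_img g) NkT; rewrite limgD g_onto => <-.
have /eqP-> : (g @: lker g == 0)%VS by rewrite -lkerE.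
by rewrite addv0.
Qed.

(** A subalgebra of least dimension among those with image [V] maps onto [V]
    essentially. *)
Lemma saturated_lift_subalgebra (L K : lieType F) (f : 'Hom(L, K))
    (V : subalgebra K) :
    saturated H -> is_lie_hom f -> limg f = fullv -> H (subvs_of V) ->
  exists2 U : subalgebra L, (f @: U)%VS = V & H (subvs_of U).
Proof.
move=> satH fM f_onto HV.
pose lifts n := `[< exists U : subalgebra L, (f @: U)%VS = V /\ \dim U = n >].
have lifts_ex : exists n, lifts n.
  exists (\dim (f @^-1: V)); apply/asboolP.
  by exists (Subalgebra (subalgebra_preim fM (@subalgP _ _ V))); rewrite img_preim.
case: (ex_minnP lifts_ex) => _ /asboolP[U [fUV <-]] U_min.
exists U => //; have [g [gM g_onto gE]] := corestriction fM fUV.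
apply: (saturated_essential_cover satH gM g_onto _ HV) => N sN gN.
(* [N] consists of elements of [subvs_of U]; the inclusion [i] moves it to [L],
   where it competes with [U] for least dimension. *)
pose i := linfun (vsval : subvs_of U -> L).
have iE u : i u = val u by rewrite lfunE.
have iM : is_lie_hom i by move=> x y; rewrite !iE.
have fiN : (f @: (i @: N))%VS = V.
  apply/vspaceP=> y; apply/idP/idP.
    case/memv_imgP=> _ /memv_imgP[n nN ->] ->.
    by rewrite iE -fUV memv_img // subvsP.
  move=> yV; have /memv_imgP[n nN gn] : Subvs yV \in (g @: N)%VS.
    by rewrite gN memvf.
  have -> : y = f (i n) by rewrite iE -gE -gn.
  by rewrite !memv_img.
have i_inj : lker i = 0%VS.
  apply/eqP/lker0P => x y; rewrite !iE; exact: val_inj.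
have dimN : (\dim U <= \dim N)%N.
  rewrite -(limg_dim_eq (f := i)) ?i_inj ?capv0 //.
  apply: U_min; apply/asboolP.
  by exists (Subalgebra (subalgebra_img iM sN)).
by apply/eqP; rewrite eqEdim subvf dimvf.
Qed.

Lemma homomorph_MH : homomorph (MH H).
Proof.
move=> L K MHL [f fM f_onto] M M_max.
have [U MU HU] := MHL _ (maximal_subalgebra_preim fM f_onto M_max).
pose V := Subalgebra (subalgebra_img fM (@subalgP _ _ U)).
exists V; first by rewrite /is_supplement -(img_preim M f_onto) -limgD MU.
have [g [gM g_onto _]] := corestriction fM (erefl (V : {vspace K})).
by apply: homH HU _; exists g.
Qed.

Lemma saturated_MH : saturated H -> saturated (MH H).
Proof.
move=> satH L MHL M M_max; have [_ phi_in _] := frattiniP L.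
pose f := quot_hom (frattini L).
have fM : is_lie_hom f := @quot_hom_is_lie_hom _ _ _.
have f_onto : limg f = fullv := quot_hom_onto _.
have kM : (lker f <= M)%VS by rewrite lker_quot_hom phi_in.
have [V MV HV] := MHL _ (maximal_subalgebra_img fM f_onto kM M_max).
have [U fU HU] := saturated_lift_subalgebra satH fM f_onto HV.
exists U => //; apply: eq_fullv.
apply: (subv_of_img (f := f)); first exact: subv_trans kM (addvSl _ _).
by rewrite limgD fU MV subvf.
Qed.

End Supplements.

Theorem proposition2p6 (F : fieldType) (H : lieType F -> Prop)
    (homH : homomorph H) (satH : saturated H) :
  (forall L : lieType F, MH H L <-> MH H (lie_quot (frattini L)))
  /\ homomorph (MH H) /\ saturated (MH H).
Proof.
have homMH := homomorph_MH homH; have satMH := saturated_MH homH satH.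
split=> // L; split=> [MHL|]; last exact: satMH.
apply: homMH MHL _; exists (quot_hom (frattini L)).
  exact: quot_hom_is_lie_hom.
exact: quot_hom_onto.
Qed.
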